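(* Let $A\subset\mathbf{Z}\cap[0,M-1]$ with $0\in A$, $N=\#A\geq 2$, and suppose $M<3N/2$. Let $\Omega=A+[0,1)$. Then the following are equivalent: (i) $A$ tiles $\mathbf{Z}$ by translations; (ii) $\Omega$ is a spectral set; (iii) $A$ is a complete residue system modulo $N$, i.e. $A\equiv\{0,1,\dots,N-1\}\pmod N$; (iv) $N\mathbf{Z}\oplus A=\mathbf{Z}$, i.e. every integer is uniquely of the form $a+Nk$ with $a\in A$, $k\in\mathbf{Z}$ (equivalently $\Omega+N\mathbf{Z}$ tiles $\mathbf{R}$); (v) $\Lambda=N^{-1}\mathbf{Z}$ is a spectrum for $\Omega$.
   Context: A finite set $A\subset\mathbf{Z}$ tiles $\mathbf{Z}$ by translations if there is $B\subset\mathbf{Z}$ such that every integer is uniquely of the form $a+b$, $a\in A$, $b\in B$. A set $\Lambda\subset\mathbf{R}$ is a spectrum for $\Omega$ if $\{e^{2\pi i\lambda x}\}_{\lambda\in\Lambda}$ is an orthogonal basis of $L^2(\Omega)$; $\Omega$ is a spectral set if it has a spectrum. *)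

(* Defs.v *)
From HB Require Import structures.
From mathcomp Require Import all_boot all_order all_algebra.
From mathcomp Require Import finmap.
From mathcomp Require Import all_classical all_reals all_analysis.
Set Implicit Arguments. Unset Strict Implicit. Unset Printing Implicit Defensive.
Import Order.TTheory GRing.Theory Num.Theory.
Local Open Scope ring_scope.
Local Open Scope classical_set_scope.


Definition tiles_Z (A : {fset int}) : Prop :=
  exists B : set int, forall z : int,
    exists! p : int * int, [/\ p.1 \in A, B p.2 & z = p.1 + p.2].

Definition complete_residue_system (A : {fset int}) (N : nat) : Prop :=
  forall r : int, 0 <= r < N%:Z ->
    exists! a : int, a \in A /\ (a = r %[mod N%:Z])%Z.

Definition direct_sum_NZ (A : {fset int}) (N : nat) : Prop :=
  forall z : int, exists! p : int * int, p.1 \in A /\ z = p.1 + N%:Z * p.2.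

Definition Omega (R : realType) (A : {fset int}) : set R :=
  [set x | exists2 a : int, a \in A & (a%:~R <= x) && (x < a%:~R + 1)].

(* Lambda is a spectrum of Omega: the exponentials e_l(x) = exp(2 pi i l x),
   l ∈ Lambda, form an orthogonal basis of L^2(Omega) (complex valued).
   Complex functions f = u + i v are represented by pairs of real functions.
   Orthogonal basis = (e_l ∈ L^2(Omega), i.e. Omega has finite measure),
   pairwise orthogonal, and complete (only the a.e.-zero function is
   orthogonal to all of them). *)
Definition spectrum (R : realType) (Om : set R) (Lam : set R) : Prop :=
  [/\ measurable Om,
      (@lebesgue_measure R Om < +oo)%E,
      (forall l m, Lam l -> Lam m -> l != m ->
         (\int[@lebesgue_measure R]_(x in Om) (cos (2 * pi * (l - m) * x))%:E = 0)%E /\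
         (\int[@lebesgue_measure R]_(x in Om) (sin (2 * pi * (l - m) * x))%:E = 0)%E) &
      (forall u v : R -> R,
         measurable_fun Om u -> measurable_fun Om v ->
         (\int[@lebesgue_measure R]_(x in Om) ((u x) ^+ 2 + (v x) ^+ 2)%:E < +oo)%E ->
         (forall l, Lam l ->
            (\int[@lebesgue_measure R]_(x in Om)
                 (u x * cos (2 * pi * l * x) + v x * sin (2 * pi * l * x))%:E = 0)%E /\
            (\int[@lebesgue_measure R]_(x in Om)
                 (v x * cos (2 * pi * l * x) - u x * sin (2 * pi * l * x))%:E = 0)%E) ->
         (@lebesgue_measure R).-negligible (Om `&` [set x | u x != 0 \/ v x != 0]))].

Definition spectral_set (R : realType) (Om : set R) : Prop :=
  exists Lam : set R, spectrum Om Lam.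

(* Main.v *)
Require Import Defs.
From HB Require Import structures.
From mathcomp Require Import all_boot all_order all_algebra.
From mathcomp Require Import finmap.
From mathcomp Require Import all_classical all_reals all_analysis.
From mathcomp Require Import measurable_realfun complex.
From mathcomp Require Import zify ring lra.
Set Implicit Arguments. Unset Strict Implicit. Unset Printing Implicit Defensive.
Import Order.TTheory GRing.Theory Num.Theory.
Import numFieldNormedType.Exports.
Local Open Scope ring_scope.
Local Open Scope classical_set_scope.

(** Tilings.  If [A (+) B = Z], two elements of [B] differ by more than [M/2],
    and 0 and max A in [A] then force consecutive gaps of [B] to be equal, so
    that [B] is an arithmetic progression of step [N].

    Spectra.  Completeness tested on step functions shows that a spectrum
    meets at least [N] classes modulo 1.  With [z = exp(2 pi i l)], the
    quotients of [N] such numbers are, apart from 1, roots of the polynomial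
    [sum_(a in A) X^a] of degree less than [M], so the quotient set has at
    most [M < 3N/2] elements and is therefore a group [H] of roots of unity.
    Since [sum_(a in A) X^a] vanishes on [H] minus 1, [A] is equidistributed
    modulo [|H|], which is only possible if [|H| = N].

    Completeness of [Z/N].  The functions orthogonal to all exponentials are
    stable under multiplication by trigonometric polynomials, and
    [(1 - W^n)^(2^n)] converges boundedly to the indicator of [W < 1/2] on
    [0 <= W <= 1]; taking for [W] a shifted cosine of period [N] isolates the
    arcs [(a, t)] with [t < a + 1], and Lebesgue differentiation concludes. *)

(** * Quotient sets of small doubling and equidistributed residues *)

(* For x = y / z in h, the sets s / y and s / z both lie in h, so that more
   than half of the t in s satisfy t x in s; for x, y in h two such halves meet,
   and a common t gives x / y = (t x) / (t y). *)
Lemma size_quotients_subgroup (F : fieldType) (s h : seq F) :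
  uniq s -> 0 \notin s -> uniq h ->
  {in s &, forall x y, x / y \in h} ->
  (forall x, x \in h -> exists y z, [/\ y \in s, z \in s & x = y / z]) ->
  (2 * size h < 3 * size s)%N ->
  {in h &, forall x y, x / y \in h}.
Proof.
move=> us s0 uh sh hs lt_h.
have nz x : x \in s -> x != 0 by apply: contraTneq => ->.
have count_meet (p q t : seq F) : uniq p -> uniq q -> uniq t ->
    {subset p <= t} -> {subset q <= t} ->
    (size p + size q <= size t + size [seq x <- p | x \in q])%N.
  move=> up uq ut pt qt.
  have -> : (size p = size [seq x <- p | x \in q] + size [seq x <- p | x \notin q])%N.
    by rewrite !size_filter -(count_predC (mem q) p).
  have : (size ([seq x <- p | x \notin q] ++ q) <= size t)%N.
    apply: uniq_leq_size.
      rewrite cat_uniq filter_uniq // uq andbT /=.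
      by apply/hasPn => x xq; rewrite mem_filter /= xq.
    move=> x; rewrite mem_cat mem_filter => /orP[/andP[_ /pt]|/qt] //.
  by rewrite size_cat => H; rewrite -addnA [leqRHS]addnC leq_add2l.
have half x : x \in h -> (size s < 2 * size [seq y <- s | (y * x)%R \in s])%N.
  move=> /hs [y [z [ys zs ->]]].
  have ynz := nz _ ys; have znz := nz _ zs.
  pose p := [seq t / y | t <- s]; pose q := [seq t / z | t <- s].
  have /= := count_meet q p h _ _ uh.
  have uq : uniq q by rewrite map_inj_uniq // => a b /mulIf -> //; rewrite invr_eq0.
  have up : uniq p by rewrite map_inj_uniq // => a b /mulIf -> //; rewrite invr_eq0.
  rewrite !size_map => /(_ uq up).
  have -> : size [seq x0 <- q | x0 \in p] = size [seq y0 <- s | y0 * (y / z) \in s].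
    rewrite filter_map size_map; congr size; apply: eq_filter => t /=.
    apply/mapP/idP => [[w ws e]|H].
      suff -> : t * (y / z) = w by [].
      by rewrite mulrCA e mulrC divfK.
    exists (t * (y / z)) => //.
    by rewrite mulrA mulrAC mulrK // unitfE.
  have qh : {subset q <= h} by move=> _ /mapP[t ts ->]; apply: sh.
  have ph : {subset p <= h} by move=> _ /mapP[t ts ->]; apply: sh.
  move=> /(_ qh ph); move: lt_h; move: (size s) (size h) (size (seq.filter _ _)) => a b c; lia.
move=> x y xh yh.
have hx := half _ xh; have hy := half _ yh.
have [w] : exists w, w \in [seq t <- s | (t * x \in s) && (t * y \in s)].
  case E: [seq t <- s | (t * x \in s) && (t * y \in s)] => [|w r]; last first.
    by exists w; rewrite inE eqxx.
  have : (size [seq t <- s | (t * x)%R \in s] + size [seq t <- s | (t * y)%R \in s] <= size s)%N.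
    rewrite -size_cat; apply: uniq_leq_size.
      rewrite cat_uniq !filter_uniq //= andbT.
      apply/hasPn => t; rewrite !mem_filter /= => /andP[ty ts].
      apply/negP => /andP[tx _].
      have : t \in [::] by rewrite -E mem_filter tx ty.
      by [].
    by move=> t; rewrite mem_cat !mem_filter => /orP[] /andP[].
  move: hx hy; move: (size s) (size (seq.filter _ _)) (size (seq.filter _ _)) => a b c; lia.
rewrite mem_filter => /andP[/andP[wx wy] ws].
have -> : x / y = (w * x) / (w * y) by rewrite -mulf_div divff ?mul1r ?nz.
exact: sh.
Qed.

(** Division by [x] permutes [h], so the product of [h] is unchanged when divided by
    [x ^+ size h]. *)
Lemma expf_subgroup_size (F : fieldType) (h : seq F) (x : F) :
  uniq h -> 0 \notin h -> {in h &, forall x y, x / y \in h} ->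
  x \in h -> x ^+ size h = 1.
Proof.
move=> uh h0 hd xh.
have nz y : y \in h -> y != 0 by apply: contraTneq => ->.
have pnz : \prod_(y <- h) y != 0.
  by rewrite prodf_seq_neq0; apply/allP => y /nz.
have e : perm_eq [seq y / x | y <- h] h.
  have u : uniq [seq y / x | y <- h].
    by rewrite map_inj_uniq // => a b /mulIf -> //; rewrite invr_eq0 nz.
  apply: uniq_perm => //.
  apply: (uniq_min_size u _ _).2; last by rewrite size_map.
  by move=> _ /mapP[y yh ->]; apply: hd.
have : \prod_(y <- h) (y / x) = \prod_(y <- h) y.
  by rewrite -[RHS](perm_big _ e) big_map.
rewrite big_split /= big_const_seq count_predT iter_mulr mulr1 exprVn.
move/(congr1 (fun t => t * (\prod_(y <- h) y)^-1)).
by rewrite mulrAC divff // mul1r => /eqP; rewrite invr_eq1 => /eqP.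
Qed.

(* The polynomial sum_a X^(a mod n) has degree < n and vanishes at the n - 1
   elements of h other than 1, hence is a multiple of 1 + X + ... + X^(n-1). *)
Lemma equidistributed_residues (F : numFieldType) (h : seq F) (A : seq nat) :
  uniq h -> 1 \in h ->
  (forall x, x \in h -> x ^+ size h = 1) ->
  (forall x, x \in h -> x != 1 -> \sum_(a <- A) x ^+ a = 0) ->
  forall r, (r < size h)%N ->
  (size h * count (fun a => a %% size h == r)%N A = size A)%N.
Proof.
move=> uh h1 hn hA.
have n0 : (0 < size h)%N by case: (h) h1.
set n := size h in hn n0 *.
pose C : {poly F} := \sum_(a <- A) 'X^(a %% n).
pose cnt r := count (fun a => a %% n == r)%N A.
have coefC r : C`_r = (cnt r)%:R.
  rewrite /C /cnt coef_sum -sum1_count natr_sum [RHS]big_mkcond /=.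
  by apply: eq_bigr => a _; rewrite coefXn eq_sym; case: eqP.
have sizeC : (size C <= n)%N.
  apply: (leq_trans (size_sum _ _ _)); apply/bigmax_leqP_seq => a _ _.
  by rewrite size_polyXn ltn_mod.
(* The multiple is chosen to cancel the coefficient of index n - 1: [D] then has size at most n - 1,
   but n - 1 roots. *)
pose D := C - C`_n.-1 *: \poly_(i < n) 1.
have D0 : D = 0.
  apply/eqP/negPn/negP => Dn0.
  have /(_ (rem 1 h)) := max_poly_roots Dn0.
  rewrite rem_uniq // size_rem // => /(_ _ isT) lt_sz.
  have rt : all (root D) (rem 1 h).
    apply/allP => x; rewrite mem_rem_uniq // inE => /andP[x1 xh].
    have geo : (\poly_(i < n) (1 : F)).[x] = 0.
      rewrite horner_poly; under eq_bigr do rewrite mul1r.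
      apply/(mulfI (_ : x - 1 != 0)); first by rewrite subr_eq0.
      by rewrite -subrX1 hn // subrr mulr0.
    rewrite /root /D hornerD hornerN hornerZ geo mulr0 subr0 /C horner_sum.
    apply/eqP; rewrite -[RHS](hA x xh x1); apply: eq_bigr => a _.
    by rewrite hornerXn expr_mod // hn.
  move: (lt_sz rt); rewrite -/n ltnNge => /negP; apply.
  apply/leq_sizeP => j; rewrite leq_eqVlt => /orP[/eqP <-|nj].
    by rewrite coefB coefZ coef_poly prednK // leqnn mulr1 subrr.
  have {}nj : (n <= j)%N by rewrite -(prednK n0).
  rewrite coefB coefZ coef_poly ltnNge nj mulr0 subr0.
  by move/leq_sizeP : sizeC; apply.
have cst r : (r < n)%N -> cnt r = cnt n.-1.
  move=> rn; apply/eqP; rewrite -(eqr_nat F) -!coefC.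
  have : D`_r = 0 by rewrite D0 coef0.
  by rewrite coefB coefZ coef_poly rn mulr1 => /subr0_eq ->.
have total : (\sum_(r < n) cnt r = size A)%N.
  rewrite /cnt; under eq_bigr do rewrite -sum1_count big_mkcond.
  rewrite exchange_big /= -[RHS]sum1_size; apply: eq_bigr => a _.
  rewrite -big_mkcond (big_pred1 (Ordinal (ltn_pmod a n0))) //.

move=> r rn; rewrite -/(cnt r) -total; under eq_bigr => i _ do rewrite cst //.
by rewrite sum_nat_const card_ord cst.
Qed.

(** The algebraic core of the spectral implication: [s] stands for N values exp(2 pi i l) with [l]
    in the spectrum. *)
Lemma spectral_residues (F : numFieldType) (M : nat) (A : seq nat) (s : seq F) :
  all (fun a => a < M)%N A -> uniq s -> 0 \notin s -> size s = size A ->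
  (0 < size A)%N -> (2 * M < 3 * size A)%N ->
  {in s &, forall x y, x != y -> \sum_(a <- A) (x / y) ^+ a = 0} ->
  forall r, (r < size A)%N -> count (fun a => a %% size A == r)%N A = 1%N.
Proof.
move=> AM us s0 sA A0 lt_M sorth.
have nz x : x \in s -> x != 0 by apply: contraTneq => ->.
pose h := undup [seq x / y | x <- s, y <- s].
have uh : uniq h by apply: undup_uniq.
have sh : {in s &, forall x y, x / y \in h}.
  by move=> x y xs ys; rewrite mem_undup; apply: allpairs_f.
have hs x : x \in h -> exists y z, [/\ y \in s, z \in s & x = y / z].
  by rewrite mem_undup => /allpairsP[[y z] /= [ys zs ->]]; exists y, z.
have [y ys] : exists y, y \in s by case: (s) sA A0 => [<- //|y t _ _]; exists y; rewrite inE eqxx.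
have h1 : 1 \in h by rewrite -(divff (nz y ys)) sh.
have hA x : x \in h -> x != 1 -> \sum_(a <- A) x ^+ a = 0.
  move=> /hs[u [v [us' vs ->]]] uv1; apply: sorth => //.
  by apply: contraNneq uv1 => ->; rewrite divff ?nz.
have hM : (size h <= M)%N.
  pose P : {poly F} := \sum_(a <- A) 'X^a.
  have P0 : P != 0.
    apply: contraTneq A0 => /(congr1 (fun p => p.[1])).
    rewrite horner0 /P horner_sum; under eq_bigr do rewrite hornerXn expr1n.
    by rewrite big_const_seq count_predT iter_addr addr0 => /eqP; rewrite pnatr_eq0 -leqn0 leqNgt.
  have := @max_poly_roots _ P (rem 1 h) P0.
  rewrite rem_uniq // size_rem //.
  have sP : (size P <= M)%N.
    apply: (leq_trans (size_sum _ _ _)); apply/bigmax_leqP_seq => a aA _.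
    by rewrite size_polyXn (allP AM).
  have n0 : (0 < size h)%N by case: (h) h1.
  move=> /(_ _ isT) H; rewrite -(prednK n0); apply: leq_trans sP; apply: H.
  apply/allP => x; rewrite mem_rem_uniq // inE => /andP[x1 xh].
  rewrite /root /P horner_sum; apply/eqP; rewrite -[RHS](hA x xh x1).
  by apply: eq_bigr => a _; rewrite hornerXn.
have h0 : 0 \notin h.
  apply/negP => /hs[u [v [us' vs /esym/eqP]]].
  by rewrite mulf_eq0 invr_eq0 (negPf (nz _ us')) (negPf (nz _ vs)).
have hd : {in h &, forall x y, x / y \in h}.
  apply: (size_quotients_subgroup us s0 uh sh hs).
  by rewrite sA; apply: leq_ltn_trans lt_M; rewrite leq_mul2l.
have hn x : x \in h -> x ^+ size h = 1 by apply: expf_subgroup_size.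
have eqd := equidistributed_residues uh h1 hn hA.
have Ah : (size A <= size h)%N.
  rewrite -sA -(size_map (fun x => x / y)); apply: uniq_leq_size.
    by rewrite map_inj_uniq // => a b /mulIf -> //; rewrite invr_eq0 nz.
  by move=> _ /mapP[t ts ->]; apply: sh.
have n0 : (0 < size h)%N by apply: leq_trans Ah.
(* The positive number |A| is a multiple of |h|, which gives |h| <= |A|; [Ah] is the other
   inequality. *)
have hAe : size h = size A.
  have := eqd 0%N n0; case: (count _ _) => [|c] e; first by rewrite -e muln0 in A0.
  by apply/eqP; rewrite eqn_leq Ah andbT -e mulnS leq_addr.
move=> r; rewrite -hAe => /eqd /eqP; rewrite -hAe -[X in _ == X]muln1.
by rewrite eqn_pmul2l // => /eqP.
Qed.

(** * Tilings of the integers *)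

Lemma size_uniq_int_interval (l : seq int) (n : nat) :
  uniq l -> {in l, forall x, 0 <= x < n%:Z} -> (size l <= n)%N.
Proof.
move=> ul ln; rewrite -(size_map absz) -(size_iota 0 n); apply: uniq_leq_size.
  rewrite map_inj_in_uniq // => x y /ln/andP[x0 _] /ln/andP[y0 _]; lia.
by move=> _ /mapP[x /ln xn ->]; rewrite mem_iota; lia.
Qed.

(** Reduction modulo [d] is a bijection from [A] onto [0, d). This identifies the step of a
    progression with the cardinality of [A]. *)
Lemma complete_residue_system_of_bijection (A : {fset int}) (d : nat) : (0 < d)%N ->
  {in A &, forall a a', (a = a' %[mod d%:Z])%Z -> a = a'} ->
  (forall r : int, 0 <= r < d%:Z -> exists2 a, a \in A & (a = r %[mod d%:Z])%Z) ->
  d = #|` A|%fset /\ complete_residue_system A d.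
Proof.
move=> d0 inj surj; split; last first.
  move=> r /surj[a aA ar]; exists a; split=> // a' [a'A a'r].
  by apply: inj => //; rewrite ar a'r.
pose l := [seq (a %% d%:Z)%Z | a <- A].
have dz : d%:Z != 0 by lia.
have sl : size l = #|` A|%fset by rewrite size_map.
rewrite -sl; apply/eqP; rewrite eqn_leq; apply/andP; split; last first.
  apply: size_uniq_int_interval.
    by rewrite map_inj_in_uniq ?fset_uniq.
  by move=> _ /mapP[a _ ->]; rewrite modz_ge0 //= ltz_mod.
rewrite -(size_iota 0 d) -(size_map Posz).
apply: uniq_leq_size; first by rewrite map_inj_uniq ?iota_uniq // => ? ? [].
move=> x /mapP[r]; rewrite mem_iota => rd ->.
have [|a aA ar] := surj r%:Z; first lia.
by apply/mapP; exists a => //; rewrite ar modz_small //; lia.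
Qed.

Section Tiling.
Variables (A : {fset int}) (M : nat) (B : set int).
Hypothesis A_bound : forall a, a \in A -> 0 <= a <= M%:Z - 1.
Hypothesis A0 : 0 \in A.
Hypothesis A_large : (2 * M < 3 * #|` A|%fset)%N.
Hypothesis B_cover : forall z, exists a b, [/\ a \in A, B b & z = a + b].
Hypothesis B_inj : forall a b a' b', a \in A -> a' \in A -> B b -> B b' ->
  a + b = a' + b' -> b = b'.

(* For d = b' - b <= M/2, disjointness of A and A + d gives 2|A| <= M + d, and
   folding [d, M) onto [0, M - d) is injective on A, so that |A| <= M - d. *)
Lemma translate_gap_large b b' : B b -> B b' -> b < b' -> M%:Z < 2 * (b' - b).
Proof.
move=> Bb Bb' lt_b; rewrite ltNge; apply/negP => le_M.
pose d := b' - b; have d0 : 0 < d by rewrite subr_gt0.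
have disj a a' : a \in A -> a' \in A -> a + d <> a'.
  move=> aA a'A e; have := B_inj aA a'A Bb' Bb; rewrite /d in e; lia.
have h1 : (#|` A|%fset <= M - `|d|)%N.
  (* By [le_M], d <= M - d, so the points below d, which stay in place, also lie in [0, M - d). *)
  pose g (x : int) := if x < d then x else x - d.
  rewrite -(size_map g); apply: size_uniq_int_interval.
    rewrite map_inj_in_uniq ?fset_uniq // => x y xA yA.
    have := disj _ _ xA yA; have := disj _ _ yA xA; rewrite /g.
    by do 2 case: ltP => ?; lia.
  move=> _ /mapP[x xA ->]; have := A_bound xA; rewrite /g.
  by case: ltP => ?; rewrite /d in d0 *; lia.
have h2 : (#|` A|%fset + #|` A|%fset <= M + `|d|)%N.
  rewrite -{2}(size_map (fun x => x + d)) -size_cat.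
  apply: size_uniq_int_interval.
    rewrite cat_uniq fset_uniq /= map_inj_uniq ?fset_uniq ?andbT; last exact: addIr.
    by apply/hasPn => _ /mapP[x xA ->]; apply/negP => /(disj _ _ xA); apply.
  by move=> y; rewrite mem_cat => /orP[/A_bound|/mapP[x /A_bound ? ->]]; lia.
(* The sum of the two bounds is 3|A| <= 2M. *)
move: h1 h2 le_M; rewrite -/d; move: A_large; move: #|` A|%fset => N; lia.
Qed.

Definition gap (b d : int) :=
  [/\ B b, B (b + d), 0 < d & forall c, B c -> b < c -> b + d <= c].

Lemma gap_exists b : B b -> exists d, gap b d.
Proof.
move=> Bb.
have ex : exists n : nat, `[< B (b + 1 + n%:Z) >].
  (* Since a <= M - 1, the translate that covers b + M starts beyond b. The search begins at b + 1,
     hence the gap n + 1 below. *)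
  have [a [c [/A_bound aA Bc e]]] := B_cover (b + M%:Z).
  exists (absz (M%:Z - a - 1)%R); apply/asboolP.
  by have -> : b + 1 + (absz (M%:Z - a - 1)%R)%:Z = c by lia.
case: (ex_minnP ex) => n /asboolP Bn nmin.
have d0 : 0 < n%:Z + 1 by rewrite ltzD1 le0z_nat.
exists (n%:Z + 1); split => //.
  by have -> : b + (n%:Z + 1) = b + 1 + n%:Z by lia.
move=> c Bc bc; have := nmin (absz (c - b - 1)%R).
have -> : b + 1 + (absz (c - b - 1)%R)%:Z = c by lia.
move=> /(_ (asboolT Bc)); lia.
Qed.

Lemma max_element : exists2 m, m \in A & forall a, a \in A -> a <= m.
Proof.
have ex : exists n : nat, n%:Z \in A by exists 0%N.
have bd (n : nat) : n%:Z \in A -> (n <= M)%N by move/A_bound; lia.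
case: (ex_maxnP ex bd) => m mA mmax; exists m%:Z => // a aA.
have a0 := A_bound aA; have := mmax (absz a).
have -> : (absz a)%:Z = a by lia.
by move=> /(_ aA); lia.
Qed.

(* If d < d', the point b + 2d cannot be covered (0 + (b + d) = d + b excludes
   d from A); if d' < d, the same holds for b + d + max A - d'. *)
Lemma gap_constant b d d' : gap b d -> gap (b + d) d' -> d' = d.
Proof.
move=> [Bb Bd d0 bd] [_ Bd' d'0 bd'].
have dM := translate_gap_large Bb Bd; have d'M := translate_gap_large Bd Bd'.
case: (ltgtP d' d) => // lt_d; exfalso.
  have [m mA mmax] := max_element.
  have [a [c [aA Bc e]]] := B_cover (b + d + m - d').
  have am := mmax _ aA; have a0 := A_bound aA; have m0 := A_bound mA.
  (* As a <= m, c exceeds b. If c = b + d, then a + (b + d + d') = m + (b + d); if c >= b + d + d',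
     then a >= 0 would require m >= 2d' > M. *)
  have c1 : b + d <= c by apply: bd => //; lia.
  move: c1; rewrite le_eqVlt => /orP[/eqP ce|/(bd' _ Bc)]; last lia.
  have := B_inj aA mA Bd' Bd; lia.
have [a [c [aA Bc e]]] := B_cover (b + d + d).
have a0 := A_bound aA.
case: (ltP (b + d) c) => [/(bd' _ Bc)|cb]; first lia.
(* For c <= b one would have a >= 2d > M; there remains c = b + d and a = d. *)
case: (ltP b c) => [/(bd _ Bc) cb'|cb']; last lia.
have := B_inj aA A0 Bb Bd; lia.
Qed.

(** From [b] onwards [B] is the progression of step [d], so [A] meets every class modulo [d] exactly
    once, and d = |A|. *)
Lemma tiling_complete_residue_system : complete_residue_system A #|` A|%fset.
Proof.
have [_ [b [_ Bb _]]] := B_cover 0.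
have [d gd] := gap_exists Bb.
have gaps (k : nat) : gap (b + d * k%:Z) d.
  elim: k => [|k IH]; first by rewrite mulr0 addr0.
  have -> : b + d * k.+1%:Z = b + d * k%:Z + d by lia.
  have [d' gd'] : exists d', gap (b + d * k%:Z + d) d' by apply: gap_exists; case: IH.
  by move: (gd'); rewrite (gap_constant IH gd').
have d0 : 0 < d by case: gd.
(* The progression is known only upwards from [b]; z >= b + M ensures that the translate covering
   [z] is there. *)
have cover z : b + M%:Z <= z -> exists2 a, a \in A & (a = z - b %[mod d])%Z.
  move=> bz; have [a [c [aA Bc e]]] := B_cover z.
  have a0 := A_bound aA.
  exists a => //.
  have cb0 : 0 <= c - b by lia.
  pose k := ((c - b) %/ d)%Z.
  have k0 : 0 <= k by rewrite divz_ge0.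
  have ke : k = (absz k) by lia.
  have [_ _ _ gk] := gaps (absz k).
  have cE := divz_eq (c - b) d; have r0 := modz_ge0 (c - b) (lt0r_neq0 d0).
  have rd := ltz_pmod (c - b) d0; rewrite -/k in cE.
  suff rE : ((c - b) %% d)%Z = 0.
    have -> : z - b = k * d + a by lia.
    by rewrite modzMDl.
  apply/eqP; rewrite eq_le r0 andbT leNgt; apply/negP => rgt.
  have := gk c Bc; rewrite -ke; lia.
pose n := (absz d); have dn : d = n%:Z by rewrite /n; lia.
have [] := @complete_residue_system_of_bijection A n.
- by rewrite /n; lia.
- suff main a a' : a \in A -> a' \in A -> a <= a' -> (a = a' %[mod d])%Z -> a = a'.
    move=> a a' aA a'A; rewrite -dn => e.
    by case/orP: (le_total a a') => le_a; [exact: main|apply/esym/main].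
  (* With a' = a + q d, the point a' + b = a + (b + q d) has two decompositions unless q = 0. *)
  move=> aA a'A le_a /eqP; rewrite eq_sym eqz_mod_dvd => /dvdzP[q qe].
  have q0 : 0 <= q by rewrite -(pmulr_lge0 _ d0) -qe subr_ge0.
  have [Bq _ _ _] := gaps (absz q).
  have := B_inj aA a'A Bq Bb; lia.
- move=> r rn; rewrite -dn in rn *.
  (* The term d M brings the point into the range of [cover] and leaves its class modulo d
     unchanged. *)
  have [|a aA ae] := cover (r + b + d * M%:Z); first by nia.
  exists a => //; rewrite ae.
  have -> : r + b + d * M%:Z - b = M%:Z * d + r by lia.
  by rewrite modzMDl.
- by move=> <-.
Qed.

End Tiling.

Lemma tiles_Z_complete_residue_system (A : {fset int}) (M : nat) :
  (forall a, a \in A -> 0 <= a <= M%:Z - 1) -> 0 \in A ->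
  (2 * M < 3 * #|` A|%fset)%N -> tiles_Z A ->
  complete_residue_system A #|` A|%fset.
Proof.
move=> AM A0 lt_M [B tB]; apply: (@tiling_complete_residue_system A M B) => //.
  by move=> z; have [[a b] [[/= aA Bb ->] _]] := tB z; exists a, b.
move=> a b a' b' aA a'A Bb Bb' e; have [p [_ up]] := tB (a + b).
have e1 := up (a, b) (And3 aA Bb erefl).
by have := up (a', b') (And3 a'A Bb' e); rewrite e1 => -[].
Qed.

Lemma complete_residue_system_direct_sum (A : {fset int}) (N : nat) :
  (0 < N)%N -> complete_residue_system A N -> direct_sum_NZ A N.
Proof.
move=> N0 crs z.
have [|a [[aA ae] ua]] := crs (z %% N%:Z)%Z.
  by rewrite modz_ge0 ?ltz_pmod //; lia.
rewrite modz_mod in ae ua.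
have /dvdzP[q qe] : (N%:Z %| z - a)%Z by rewrite -eqz_mod_dvd ae.
exists (a, q); split; first by split => //=; lia.
move=> [a' q'] [/= a'A ze].
have e : a = a' by apply: ua; split => //; rewrite ze addrC mulrC modzMDl.
rewrite -e in ze *; congr pair.
have : N%:Z * (q' - q) = 0 by lia.
by move/eqP; rewrite mulf_eq0 subr_eq0 => /orP[|/eqP ->//]; lia.
Qed.

Lemma direct_sum_tiles_Z (A : {fset int}) (N : nat) :
  direct_sum_NZ A N -> tiles_Z A.
Proof.
move=> ds; exists [set b | exists k, b = N%:Z * k] => z.
have [[a k] [[/= aA ze] u]] := ds z.
exists (a, N%:Z * k); split; first by split => //=; exists k.
move=> [a' _] [/= a'A [k' ->] ze'].
by have [-> ->] := u (a', k') (conj a'A ze').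
Qed.

(** * Trigonometric integrals over unions of unit intervals *)

Section Integrals.
Variable R : realType.
Notation mu := (@lebesgue_measure R).

Definition unit_itv (a : int) : set R := `[a%:~R, (a%:~R + 1)[.

Lemma Omega_bigsetU (A : {fset int}) :
  @Omega R A = \big[setU/set0]_(a <- A) unit_itv a.
Proof.
rewrite -bigcup_seq; apply/seteqP; split => x /=.
  by move=> [a aA ax]; exists a => //; rewrite /unit_itv /= in_itv.
by move=> [a aA]; rewrite /unit_itv /= in_itv /= => ax; exists a.
Qed.

Lemma unit_itv_inj (a b : int) (x : R) : unit_itv a x -> unit_itv b x -> a = b.
Proof.
rewrite /unit_itv /= !in_itv /= => /andP[a1 a2] /andP[b1 b2].
have : a%:~R < (b + 1)%:~R :> R by rewrite intrD; apply: le_lt_trans b2.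
have : b%:~R < (a + 1)%:~R :> R by rewrite intrD; apply: le_lt_trans a2.
by rewrite !ltr_int; lia.
Qed.

Lemma trivIset_unit_itv (D : set int) : trivIset D unit_itv.
Proof.
apply/trivIsetP => a b _ _ ab; rewrite -subset0 => x [xa xb].
by case/eqP: ab; apply: unit_itv_inj xa xb.
Qed.

Lemma measurable_Omega (A : {fset int}) : measurable (@Omega R A).
Proof. by rewrite Omega_bigsetU; apply: bigsetU_measurable => a _; exact: measurable_itv. Qed.

Lemma integral_Omega (A : {fset int}) (f : R -> R) : measurable_fun (@Omega R A) f ->
  (\int[mu]_(x in @Omega R A) (f x)%:E =
   \sum_(a <- A) \int[mu]_(x in unit_itv a) (f x)%:E)%E.
Proof.
move=> mf; rewrite Omega_bigsetU; apply: integral_bigsetU_EFin.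
- by move=> a; exact: measurable_itv.
- exact: fset_uniq.
- exact: trivIset_unit_itv.
- by rewrite -Omega_bigsetU; apply/measurable_EFinP.
Qed.

Lemma measure_unit_itv a : mu (unit_itv a) = 1%E.
Proof.
rewrite /unit_itv lebesgue_measure_itv /= lte_fin ltrDl ltr01.
by rewrite -EFinD addrAC subrr add0r.
Qed.

Lemma measure_Omega_lty (A : {fset int}) : (mu (@Omega R A) < +oo)%E.
Proof.
rewrite Omega_bigsetU measure_fbigsetU.
- by rewrite (eq_bigr (fun=> 1%E)) ?sumEFin ?ltry // => a _; exact: measure_unit_itv.
- by move=> a _; exact: measurable_itv.
- exact: trivIset_unit_itv.
Qed.

Lemma measurable_cosM (D : set R) (w : R) : measurable_fun D (fun x => cos (w * x)).
Proof.
apply: (@measurable_funS _ _ _ _ setT) => //; apply: continuous_measurable_fun => x.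
by apply: continuous_comp; [exact: mulrl_continuous|exact: continuous_cos].
Qed.

Lemma measurable_sinM (D : set R) (w : R) : measurable_fun D (fun x => sin (w * x)).
Proof.
apply: (@measurable_funS _ _ _ _ setT) => //; apply: continuous_measurable_fun => x.
by apply: continuous_comp; [exact: mulrl_continuous|exact: continuous_sin].
Qed.

Lemma integral_FTC (F f : R -> R) (s t : R) : s < t -> continuous f ->
  (forall x : R, is_derive x 1 F (f x)) ->
  (\int[mu]_(x in `[s, t[) (f x)%:E = (F t - F s)%:E)%E.
Proof.
move=> st cf dF; rewrite integral_itv_bndo_bndc; last first.
  by apply/measurable_EFinP/(@measurable_funS _ _ _ _ setT) => //; apply: continuous_measurable_fun.
have cF : continuous F.
  by move=> x; apply: differentiable_continuous; apply/derivable1_diffP.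
rewrite (@continuous_FTC2 _ f F) //.
- exact: continuous_subspaceT.
- split => [x _|//|].
  + by [].
  + exact/cvg_at_right_filter/cF.
  + exact/cvg_at_left_filter/cF.
- by move=> x _; rewrite derive1E derive_val.
Qed.

Lemma integral_cosM (w s t : R) : w != 0 -> s < t ->
  (\int[mu]_(x in `[s, t[) (cos (w * x))%:E = ((sin (w * t) - sin (w * s)) / w)%:E)%E.
Proof.
move=> w0 st; rewrite mulrBl; apply: (@integral_FTC (fun x => sin (w * x) / w)) => //.
  by move=> x; apply: continuous_comp; [exact: mulrl_continuous|exact: continuous_cos].
move=> x; apply: is_derive_eq; rewrite /GRing.scale /=; field.
exact: w0.
Qed.

Lemma integral_sinM (w s t : R) : w != 0 -> s < t ->
  (\int[mu]_(x in `[s, t[) (sin (w * x))%:E = ((cos (w * s) - cos (w * t)) / w)%:E)%E.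
Proof.
move=> w0 st.
have -> : (cos (w * s) - cos (w * t)) / w = (- cos (w * t) / w) - (- cos (w * s) / w).
  by ring.
apply: (@integral_FTC (fun x => - cos (w * x) / w)) => //.
  by move=> x; apply: continuous_comp; [exact: mulrl_continuous|exact: continuous_sin].
move=> x; apply: is_derive_eq; rewrite /GRing.scale /=; field.
exact: w0.
Qed.

(* cos_mean w + i sin_mean w is the integral of exp (i w x) over [0, 1). *)
Definition cos_mean (w : R) := if w == 0 then 1 else sin w / w.
Definition sin_mean (w : R) := if w == 0 then 0 else (1 - cos w) / w.

(** The integrand is the real part of (p - i q) exp(i w x). Translation by [a] multiplies it by
    exp(i w a), and the mean over [0, 1) is a factor common to all [a]. *)
Lemma integral_trig_unit (p q w : R) (a : int) :
  (\int[mu]_(x in unit_itv a) (p * cos (w * x) + q * sin (w * x))%:E =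
   (cos_mean w * (p * cos (w * a%:~R) + q * sin (w * a%:~R)) +
    sin_mean w * (q * cos (w * a%:~R) - p * sin (w * a%:~R)))%:E)%E.
Proof.
rewrite /cos_mean /sin_mean; have [->|w0] := eqVneq w 0.
  under eq_integral do rewrite mul0r cos0 sin0 mulr1 mulr0 addr0.
  rewrite integral_cst; last exact: measurable_itv.
  by rewrite [X in (_ * X)%E]measure_unit_itv mule1 !mul0r cos0 sin0; congr EFin; ring.
pose F x := p * (sin (w * x) / w) - q * (cos (w * x) / w).
apply: (@etrans _ _ (F (a%:~R + 1) - F a%:~R)%:E); last first.
  by rewrite /F mulrDr mulr1 sinD cosD; congr EFin; field.
apply: (@integral_FTC F); first by rewrite ltrDl.
  move=> x; apply: cvgD; apply: cvgM; try exact: cvg_cst.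
    by apply: continuous_comp; [exact: mulrl_continuous|exact: continuous_cos].
  by apply: continuous_comp; [exact: mulrl_continuous|exact: continuous_sin].
move=> x; apply: is_derive_eq; rewrite /GRing.scale /=; field.
exact: w0.
Qed.

Lemma cos_periodz (x : R) (z : int) : cos (x + 2 * pi * z%:~R) = cos x.
Proof.
have pos (y : R) (n : nat) : cos (y + 2 * pi * n%:R) = cos y.
  by rewrite -[RHS](periodicn (@cosD2pi R) n) mulr_natr [2 * _]mulr_natl.
case: z => n; first exact: pos.
by rewrite NegzE -[RHS](pos _ n.+1) mulrNz mulrN pos -[LHS](pos _ n.+1) subrK.
Qed.

Lemma sin_periodz (x : R) (z : int) : sin (x + 2 * pi * z%:~R) = sin x.
Proof. by rewrite -!cosBpihalf addrAC cos_periodz. Qed.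

(** [A] represents each class modulo N once, so both sums run over one period; their difference
    telescopes to g N - g 0 = 0. *)
Lemma direct_sum_sum_periodic (A : {fset int}) (g : int -> R) :
  (0 < #|` A|%fset)%N -> direct_sum_NZ A #|` A|%fset ->
  (forall a q, g (a + (#|` A|%fset)%:Z * q) = g a) ->
  \sum_(a <- A) g (a + 1) = \sum_(a <- A) g a.
Proof.
set N := #|` A|%fset => N0 ds gper.
have N0' : 0 < N%:Z by lia.
have modI : {in A &, forall a b, (a %% N%:Z)%Z = (b %% N%:Z)%Z -> a = b}.
  move=> a b aA bA /eqP; rewrite eqz_mod_dvd => /dvdzP[q qe].
  have [p [_ up]] := ds a.
  (* The integer [a] decomposes both as a + N 0 and as b + N q. *)
  have h1 : p = (a, 0) by apply: up; split => //=; rewrite mulr0 addr0.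
  have h2 : p = (b, q) by apply: up; split => //=; lia.
  by move: h1; rewrite h2 => -[].
have e : perm_eq [seq (a %% N%:Z)%Z | a <- A] (map Posz (iota 0 N)).
  have u : uniq [seq (a %% N%:Z)%Z | a <- A] by rewrite map_inj_in_uniq ?fset_uniq.
  have u' : uniq (map Posz (iota 0 N)) by rewrite map_inj_uniq ?iota_uniq // => ? ? [].
  apply: uniq_perm => //; apply: (uniq_min_size u _ _).2; last first.
    by rewrite !size_map size_iota.
  move=> _ /mapP[a _ ->]; have := ltz_pmod a N0'; have := modz_ge0 a (lt0r_neq0 N0').
  by case: (a %% N%:Z)%Z => // n _ nN; apply/mapP; exists n => //; rewrite mem_iota.
have red (f : int -> R) : (forall a q, f (a + N%:Z * q) = f a) ->
    \sum_(a <- A) f a = \sum_(0 <= r < N) f r%:Z.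
  move=> fper; rewrite /index_iota subn0.
  rewrite -(big_map Posz xpredT f) -(perm_big _ e) big_map.
  by apply: eq_bigr => a _; rewrite {1}(divz_eq a N%:Z) addrC mulrC fper.
rewrite (red (fun a => g (a + 1))) => [|a q]; last by rewrite addrAC gper.
rewrite red //; apply/eqP; rewrite -subr_eq0 -sumrB.
have -> : \sum_(0 <= i < N) (g (i%:Z + 1) - g i%:Z) = g N%:Z - g 0.
  rewrite -(telescope_sumr (fun i : nat => g i%:Z)) //.
  by apply: eq_bigr => i _; rewrite /= (_ : i%:Z + 1 = i.+1%:Z) //; lia.
by rewrite subr_eq0 -[N%:Z]mulr1 -[X in g X]add0r gper.
Qed.

(** Each integral is a sum over [A] of increments, from a to a + 1, of a primitive that is
    N-periodic on the integers. *)
Lemma direct_sum_orthogonal (A : {fset int}) (k : int) :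
  (0 < #|` A|%fset)%N -> direct_sum_NZ A #|` A|%fset -> k != 0 ->
  let w := 2 * pi * (k%:~R / (#|` A|%fset)%:R) in
  (\int[mu]_(x in @Omega R A) (cos (w * x))%:E = 0)%E /\
  (\int[mu]_(x in @Omega R A) (sin (w * x))%:E = 0)%E.
Proof.
move=> N0 ds k0 w; set N := #|` A|%fset in w N0 ds *.
have NR : N%:R != 0 :> R by rewrite pnatr_eq0 -lt0n.
have w0 : w != 0.
  by rewrite /w !mulf_eq0 invr_eq0 intr_eq0 (negPf k0) (negPf NR) (gt_eqF (pi_gt0 R)) pnatr_eq0.
have wN (a q : int) : w * (a + N%:Z * q)%:~R = w * a%:~R + 2 * pi * (k * q)%:~R.
  by rewrite intrD !intrM /w; field.
split; rewrite integral_Omega; [|exact: measurable_cosM| |exact: measurable_sinM].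
  under eq_bigr => a _ do rewrite /unit_itv integral_cosM ?ltrDl //.
  rewrite sumEFin -mulr_suml sumrB.
  have := @direct_sum_sum_periodic A (fun a => sin (w * a%:~R)) N0 ds.
  rewrite /=; under eq_bigr do rewrite intrD.
  move=> ->; first by rewrite subrr mul0r.
  by move=> a q; rewrite wN sin_periodz.
under eq_bigr => a _ do rewrite /unit_itv integral_sinM ?ltrDl //.
rewrite sumEFin -mulr_suml sumrB.
have := @direct_sum_sum_periodic A (fun a => cos (w * a%:~R)) N0 ds.
rewrite /=; under eq_bigr do rewrite intrD.
move=> ->; first by rewrite subrr mul0r.
by move=> a q; rewrite wN cos_periodz.
Qed.

End Integrals.

(** * Completeness of the exponentials of period N *)

Section PolynomialStep.
Variable R : realType.

Lemma bernoulli_sub (x : R) (m : nat) : 0 <= x <= 1 -> 1 - m%:R * x <= (1 - x) ^+ m.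
Proof.
move=> /andP[x0 x1]; elim: m => [|m IH]; first by rewrite mul0r subr0.
have x1' : 0 <= 1 - x by rewrite subr_ge0.
rewrite exprS; apply: le_trans (ler_wpM2l x1' IH).
have : 0 <= m%:R * x ^+ 2 by rewrite mulr_ge0 ?sqr_ge0.
by rewrite -natr1; nra.
Qed.

Lemma bernoulli_add (x : R) (m : nat) : 0 <= x -> 1 + m%:R * x <= (1 + x) ^+ m.
Proof.
move=> x0; elim: m => [|m IH]; first by rewrite mul0r addr0.
have x1' : 0 <= 1 + x by rewrite addr_ge0.
rewrite exprS; apply: le_trans (ler_wpM2l x1' IH).
have : 0 <= m%:R * x ^+ 2 by rewrite mulr_ge0 ?sqr_ge0.
by rewrite -natr1; nra.
Qed.

(** The exponent 2^n places the threshold at 1/2: 2^n w^n tends to 0 below it and to infinity above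
    it. *)
Definition step_poly (w : R) (n : nat) := (1 - w ^+ n) ^+ (2 ^ n).

Lemma step_poly_bounds w n : 0 <= w <= 1 -> 0 <= step_poly w n <= 1.
Proof.
move=> /andP[w0 w1]; have wn0 : 0 <= w ^+ n by rewrite exprn_ge0.
have wn1 : w ^+ n <= 1 by rewrite exprn_ile1.
by rewrite /step_poly exprn_ge0 ?exprn_ile1 //; lra.
Qed.

(** Bernoulli's inequality bounds the polynomial below by 1 - (2w)^n. *)
Lemma step_poly_cvg1 (w : R) : 0 <= w < 2^-1 -> step_poly w @ \oo --> (1 : R).
Proof.
move=> /andP[w0 wh].
have w1 : w <= 1 by lra.
apply: (@squeeze_cvgr _ _ _ _ (fun n => 1 - (2 * w) ^+ n) (fun=> 1)).
- near=> n; have /andP[_ ->] : 0 <= step_poly w n <= 1 by apply: step_poly_bounds; rewrite w0.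
  rewrite andbT.
  rewrite exprMn -natrX; apply: bernoulli_sub.
  by rewrite exprn_ge0 ?exprn_ile1.
- rewrite -[X in _ --> X]subr0; apply: cvgB; first exact: cvg_cst.
  by apply: cvg_expr; rewrite ger0_norm; lra.
- exact: cvg_cst.
Unshelve. all: by end_near. Qed.

(** Multiplied by (1 + w^n)^(2^n), which is at least (2w)^n, the polynomial becomes (1 -
    w^(2n))^(2^n) <= 1. It is thus at most (2w)^(-n). *)
Lemma step_poly_cvg0 (w : R) : 2^-1 < w <= 1 -> step_poly w @ \oo --> (0 : R).
Proof.
move=> /andP[wh w1].
have w0 : 0 <= w by lra.
apply: (@squeeze_cvgr _ _ _ _ (fun=> 0) (fun n => ((2 * w)^-1) ^+ n)).
- near=> n; have /andP[p_ge0 _] : 0 <= step_poly w n <= 1 by apply: step_poly_bounds; rewrite w0.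
  rewrite p_ge0 /=.
  have wn0 : 0 <= w ^+ n by rewrite exprn_ge0.
  have wn1 : w ^+ n <= 1 by rewrite exprn_ile1.
  have p0 : 0 < (2 * w) ^+ n by rewrite exprn_gt0 //; lra.
  rewrite exprVn -[X in _ <= X]mul1r ler_pdivlMr //.
  apply: (@le_trans _ _ (step_poly w n * (1 + w ^+ n) ^+ (2 ^ n))).
    apply: ler_wpM2l => //.
    rewrite exprMn -natrX; apply: le_trans (bernoulli_add _ wn0).
    by rewrite lerDr.
  rewrite /step_poly -exprMn -subr_sqr expr1n exprn_ile1 //.
    by rewrite subr_ge0 exprn_ile1.
  by rewrite gerBl sqr_ge0.
- exact: cvg_cst.
- apply: cvg_expr; rewrite ger0_norm ?invr_ge0; last by lra.
  by rewrite invf_lt1; lra.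
Unshelve. all: by end_near. Qed.

End PolynomialStep.

(** * Multipliers preserving orthogonality to a trigonometric system *)

Section Annihilator.
Variables (R : realType) (D : set R) (u : R -> R).
Notation mu := (@lebesgue_measure R).
Hypothesis mD : measurable D.
Hypothesis iu : mu.-integrable D (EFin \o u).

Definition bounded_measurable (g : R -> R) :=
  measurable_fun D g /\ exists C, forall x, `|g x| <= C.

Lemma bounded_measurable_cst c : bounded_measurable (fun=> c).
Proof. by split; [exact: measurable_cst|exists `|c|]. Qed.

Lemma bounded_measurableD g h : bounded_measurable g -> bounded_measurable h ->
  bounded_measurable (fun x => g x + h x).
Proof.
move=> [mg [C gC]] [mh [C' hC]]; split; first exact: measurable_funD.
by exists (C + C') => x; rewrite (le_trans (ler_normD _ _)) // lerD.
Qed.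

Lemma bounded_measurableM g h : bounded_measurable g -> bounded_measurable h ->
  bounded_measurable (fun x => g x * h x).
Proof.
move=> [mg [C gC]] [mh [C' hC]]; split; first exact: measurable_funM.
by exists (C * C') => x; rewrite normrM ler_pM.
Qed.

Lemma bounded_measurable_cosM w : bounded_measurable (fun x => cos (w * x)).
Proof. by split; [exact: measurable_cosM|exists 1 => x; rewrite ler_norml cos_geN1 cos_le1]. Qed.

Lemma bounded_measurable_sinM w : bounded_measurable (fun x => sin (w * x)).
Proof. by split; [exact: measurable_sinM|exists 1 => x; rewrite ler_norml sin_geN1 sin_le1]. Qed.

Lemma integrable_bounded_measurable g : bounded_measurable g ->
  mu.-integrable D (EFin \o (fun x => u x * g x)).
Proof.
move=> [mg [C gC]].
rewrite (_ : EFin \o _ = ((EFin \o u) \* (EFin \o g))%E) //.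
apply: integrableMl => //.
exists C; split; first exact: num_real.
by move=> y Cy x _ /=; apply: le_trans (gC x) _; apply: ltW.
Qed.

Definition pairing (g : R -> R) : R := \int[mu]_(x in D) (u x * g x).

Lemma pairingD g h : bounded_measurable g -> bounded_measurable h ->
  pairing (fun x => g x + h x) = pairing g + pairing h.
Proof.
move=> bg bh; rewrite /pairing -RintegralD //; try exact: integrable_bounded_measurable.
by apply: eq_Rintegral => x _; rewrite mulrDr.
Qed.

Lemma pairingZ c g : bounded_measurable g -> pairing (fun x => c * g x) = c * pairing g.
Proof.
move=> bg; rewrite /pairing -RintegralZl //; try exact: integrable_bounded_measurable.
by apply: eq_Rintegral => x _; rewrite mulrCA.
Qed.

Variable w : R.

(** Orthogonality of [u * g] to all exp(i k w x), in real form. As [g] is bounded, integrability of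
    [u] is all that the pairings require. *)
Definition trig_annihilated (g : R -> R) := bounded_measurable g /\
  forall k : int, pairing (fun x => g x * cos (k%:~R * w * x)) = 0 /\
                  pairing (fun x => g x * sin (k%:~R * w * x)) = 0.

(** These functions form an algebra containing the cosine and sine of frequency [w], hence all
    trigonometric polynomials. *)
Definition trig_multiplier (m : R -> R) := bounded_measurable m /\
  forall g, trig_annihilated g -> trig_annihilated (fun x => g x * m x).

Lemma trig_annihilatedD g h : trig_annihilated g -> trig_annihilated h ->
  trig_annihilated (fun x => g x + h x).
Proof.
move=> [bg Vg] [bh Vh]; split; first exact: bounded_measurableD.
move=> k; have [g1 g2] := Vg k; have [h1 h2] := Vh k.
split; under [X in pairing X]eq_fun do rewrite mulrDl.
  rewrite pairingD ?g1 ?h1 ?addr0 //; apply: bounded_measurableM => //; exact: bounded_measurable_cosM.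
rewrite pairingD ?g2 ?h2 ?addr0 //; apply: bounded_measurableM => //; exact: bounded_measurable_sinM.
Qed.

Lemma trig_annihilatedZ c g : trig_annihilated g -> trig_annihilated (fun x => g x * c).
Proof.
move=> [bg Vg]; split; first by apply: bounded_measurableM => //; exact: bounded_measurable_cst.
move=> k; have [g1 g2] := Vg k.
split; under [X in pairing X]eq_fun do rewrite mulrAC mulrC.
  rewrite pairingZ ?g1 ?mulr0 //; apply: bounded_measurableM => //; exact: bounded_measurable_cosM.
rewrite pairingZ ?g2 ?mulr0 //; apply: bounded_measurableM => //; exact: bounded_measurable_sinM.
Qed.

Lemma trig_multiplier_cst c : trig_multiplier (fun=> c).
Proof. by split; [exact: bounded_measurable_cst|move=> g; exact: trig_annihilatedZ]. Qed.

Lemma trig_multiplierD m m' : trig_multiplier m -> trig_multiplier m' ->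
  trig_multiplier (fun x => m x + m' x).
Proof.
move=> [bm Mm] [bm' Mm']; split; first exact: bounded_measurableD.
move=> g Vg; under eq_fun do rewrite mulrDr.
by apply: trig_annihilatedD; [exact: Mm|exact: Mm'].
Qed.

Lemma trig_multiplierM m m' : trig_multiplier m -> trig_multiplier m' ->
  trig_multiplier (fun x => m x * m' x).
Proof.
move=> [bm Mm] [bm' Mm']; split; first exact: bounded_measurableM.
move=> g Vg; under eq_fun do rewrite mulrA.
by apply: Mm'; exact: Mm.
Qed.

Lemma trig_multiplierX m n : trig_multiplier m -> trig_multiplier (fun x => m x ^+ n).
Proof.
move=> Mm; elim: n => [|n IH]; first exact: trig_multiplier_cst.
by under eq_fun do rewrite exprS; apply: trig_multiplierM.
Qed.

(** The product formulas turn frequency k into k + 1 and k - 1; the sine is treated in the same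
    way. *)
Lemma trig_multiplier_cos : trig_multiplier (fun x => cos (w * x)).
Proof.
split; first exact: bounded_measurable_cosM.
move=> g [bg Vg]; split; first by apply: bounded_measurableM => //; exact: bounded_measurable_cosM.
move=> k; have [c1 s1] := Vg (k + 1); have [c2 s2] := Vg (k - 1).
have bc j : bounded_measurable (fun x => g x * cos (j * w * x)).
  by apply: bounded_measurableM => //; exact: bounded_measurable_cosM.
have bs j : bounded_measurable (fun x => g x * sin (j * w * x)).
  by apply: bounded_measurableM => //; exact: bounded_measurable_sinM.
have e1 x : (k + 1)%:~R * w * x = k%:~R * w * x + w * x by rewrite intrD; ring.
have e2 x : (k - 1)%:~R * w * x = k%:~R * w * x - w * x by rewrite intrB; ring.
split.
  rewrite (_ : (fun x => _) = fun x => 2^-1 * (g x * cos ((k + 1)%:~R * w * x) + g x * cos ((k - 1)%:~R * w * x))).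
    by rewrite pairingZ ?pairingD ?c1 ?c2 ?addr0 ?mulr0 //; apply: bounded_measurableD.
  by apply/funext => x; rewrite e1 e2 cosD cosB; field.
rewrite (_ : (fun x => _) = fun x => 2^-1 * (g x * sin ((k + 1)%:~R * w * x) + g x * sin ((k - 1)%:~R * w * x))).
  by rewrite pairingZ ?pairingD ?s1 ?s2 ?addr0 ?mulr0 //; apply: bounded_measurableD.
by apply/funext => x; rewrite e1 e2 sinD sinB; field.
Qed.

Lemma trig_multiplier_sin : trig_multiplier (fun x => sin (w * x)).
Proof.
split; first exact: bounded_measurable_sinM.
move=> g [bg Vg]; split; first by apply: bounded_measurableM => //; exact: bounded_measurable_sinM.
move=> k; have [c1 s1] := Vg (k + 1); have [c2 s2] := Vg (k - 1).
have bc j : bounded_measurable (fun x => g x * cos (j * w * x)).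
  by apply: bounded_measurableM => //; exact: bounded_measurable_cosM.
have bs j : bounded_measurable (fun x => g x * sin (j * w * x)).
  by apply: bounded_measurableM => //; exact: bounded_measurable_sinM.
have bZ c h : bounded_measurable h -> bounded_measurable (fun x => c * h x).
  by move=> bh; apply: bounded_measurableM => //; exact: bounded_measurable_cst.
have e1 x : (k + 1)%:~R * w * x = k%:~R * w * x + w * x by rewrite intrD; ring.
have e2 x : (k - 1)%:~R * w * x = k%:~R * w * x - w * x by rewrite intrB; ring.
split.
  rewrite (_ : (fun x => _) = fun x => 2^-1 * (g x * sin ((k + 1)%:~R * w * x)) + (- 2^-1) * (g x * sin ((k - 1)%:~R * w * x))).
    by rewrite pairingD ?pairingZ ?s1 ?s2 ?mulr0 ?addr0 //; exact: bZ.
  by apply/funext => x; rewrite e1 e2 sinD sinB; field.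
rewrite (_ : (fun x => _) = fun x => (- 2^-1) * (g x * cos ((k + 1)%:~R * w * x)) + 2^-1 * (g x * cos ((k - 1)%:~R * w * x))).
  by rewrite pairingD ?pairingZ ?c1 ?c2 ?mulr0 ?addr0 //; exact: bZ.
by apply/funext => x; rewrite e1 e2 cosD cosB; field.
Qed.

End Annihilator.

(** * Functions orthogonal to all exponentials of period N *)

Section Completeness.
Variable R : realType.
Notation mu := (@lebesgue_measure R).

Lemma ltr_cos_period (N y e : R) : 0 < N -> 0 <= y -> y < e -> e <= N / 2 ->
  cos (2 * pi / N * e) < cos (2 * pi / N * y).
Proof.
move=> N0 y0 ye eN; have pi0 := pi_gt0 R.
have th0 : 0 < 2 * pi / N by rewrite divr_gt0 // mulr_gt0.
have e_pi : 2 * pi / N * e <= pi.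
  rewrite -[leRHS](_ : 2 * pi / N * (N / 2) = pi) ?ler_pM2l //.
  by field; exact: lt0r_neq0.
have ye' : 2 * pi / N * y < 2 * pi / N * e by rewrite ltr_pM2l.
have y_pi : 0 <= 2 * pi / N * y by rewrite mulr_ge0 // ltW.
rewrite ltr_cos // in_itv /= ?e_pi ?(le_trans _ (ltW ye')) //.
by rewrite y_pi (le_trans (ltW ye') e_pi).
Qed.

Lemma cos_mul_norm (w y : R) : cos (w * `|y|) = cos (w * y).
Proof. by case: (ger0P y) => // _; rewrite mulrN cosN. Qed.

Lemma cos_near_period (N y e : R) : 0 < N -> 0 <= e -> e <= N / 2 ->
  cos (2 * pi / N * e) <= cos (2 * pi / N * y) ->
  exists k : int, `|y - N * k%:~R| <= e.
Proof.
move=> N0 e0 eN le_cos.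
(* [k] is an integer nearest to y / N, so that |y - N k| <= N/2, the range where the cosine
   decreases in the absolute value. *)
pose k := Num.floor (y / N + 2^-1); exists k.
pose z := y - N * k%:~R.
have zN : `|z| <= N / 2.
  have /andP[k1 k2] := real_floor_itv (num_real (y / N + 2^-1)).
  rewrite -/k in k1 k2.
  have yN : y / N * N = y by rewrite divfK // gt_eqF.
  rewrite intrD in k2.
  have h1 := ler_wpM2r (ltW N0) k1.
  have h2 : (y / N + 2^-1) * N < (k%:~R + 1) * N by rewrite ltr_pM2r.
  rewrite mulrDl yN in h1 h2.
  by rewrite ler_norml /z; lra.
rewrite -/z leNgt; apply/negP => ez.
have := ltr_cos_period N0 e0 ez zN.
suff -> : cos (2 * pi / N * `|z|) = cos (2 * pi / N * y) by rewrite ltNge le_cos.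
rewrite cos_mul_norm -[RHS](cos_periodz _ (- k)); congr cos; rewrite /z intrN; field.
exact: lt0r_neq0.
Qed.

Variable A : {fset int}.
Let N := #|` A|%fset.
Hypothesis N_gt1 : (1 < N)%N.
Hypothesis A_sum : direct_sum_NZ A N.
Let NR0 : 0 < N%:R :> R. Proof. by rewrite ltr0n; lia. Qed.

Variable u : R -> R.
Hypothesis iu : mu.-integrable (@Omega R A) (EFin \o u).
Hypothesis u_trig : trig_annihilated (@Omega R A) u (2 * pi / N%:R) (fun=> 1).

Let mO : measurable (@Omega R A). Proof. exact: measurable_Omega. Qed.

Let M_cst k : trig_multiplier (@Omega R A) u (2 * pi / N%:R) (fun=> k).
Proof. exact: (trig_multiplier_cst mO iu). Qed.

Let M_D m m' : trig_multiplier (@Omega R A) u (2 * pi / N%:R) m ->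
  trig_multiplier (@Omega R A) u (2 * pi / N%:R) m' ->
  trig_multiplier (@Omega R A) u (2 * pi / N%:R) (fun x => m x + m' x).
Proof. exact: (trig_multiplierD mO iu). Qed.

Section Arc.
Variables (a : int) (t : R).
Hypotheses (aA : a \in A) (a_t : a%:~R < t) (t_a : t < a%:~R + 1).

(* W x < 1/2 exactly when x lies within e of c modulo N. *)
Let c := (a%:~R + t) / 2.
Let e := (t - a%:~R) / 2.
Let W x := 2^-1 - (cos (2 * pi / N%:R * (x - c)) - cos (2 * pi / N%:R * e)) / 4.

Let e_half : e <= N%:R / 2.
Proof.
have : 2 <= N%:R :> R by rewrite ler_nat.
by move: t_a; rewrite /e; lra.
Qed.

Let W_multiplier : trig_multiplier (@Omega R A) u (2 * pi / N%:R) W.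
Proof.
set th := 2 * pi / N%:R.
rewrite (_ : W = fun x => (2^-1 + cos (th * e) / 4) +
   (cos (th * x) * (- cos (th * c) / 4) + sin (th * x) * (- sin (th * c) / 4))).
  apply: M_D; first exact: M_cst.
  apply: M_D; apply: trig_multiplierM; try exact: M_cst.
    exact: (trig_multiplier_cos mO iu).
  exact: (trig_multiplier_sin mO iu).
apply/funext => x; rewrite /W -/th mulrBr cosB; by field.
Qed.

(** The divisor 4 serves here: two cosines differ by at most 2. *)
Let W_bounds x : 0 <= W x <= 1.
Proof.
rewrite /W.
have := cos_le1 (2 * pi / N%:R * (x - c)); have := cos_geN1 (2 * pi / N%:R * (x - c)).
have := cos_le1 (2 * pi / N%:R * e); have := cos_geN1 (2 * pi / N%:R * e).
by move: (cos _) (cos _) => p q; lra.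
Qed.

Let W_lt x : a%:~R < x < t -> W x < 2^-1.
Proof.
move=> /andP[ax xt].
have : `|x - c| < e by rewrite ltr_norml /c /e; lra.
move=> /(ltr_cos_period NR0 (normr_ge0 _)) /(_ e_half).
by rewrite cos_mul_norm /W; lra.
Qed.

(** Otherwise some x - N k lies in [a, t], within the unit interval of [a]; then b = a + N k, and
    uniqueness in the direct sum forces k = 0. *)
Let W_gt x : @Omega R A x -> ~~ (a%:~R <= x <= t) -> 2^-1 < W x.
Proof.
move=> [b bA bx] xat; rewrite ltNge; apply: contra xat => Wx.
have [||k xk] := @cos_near_period N%:R (x - c) e NR0 _ e_half.
- by rewrite /e; move: a_t; lra.
- by move: Wx; rewrite /W; lra.
have xk' : a%:~R <= x - N%:R * k%:~R <= t.
  by move: xk; rewrite ler_norml /c /e; lra.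
have ab : b - N%:Z * k = a.
  apply: (@unit_itv_inj R _ _ (x - N%:R * k%:~R)); rewrite /unit_itv /= in_itv /=.
    by rewrite intrB intrM; move: bx; lra.
  by move: xk' t_a; lra.
have [p [_ up]] := A_sum b.
have h1 : p = (b, 0) by apply: up; split => //=; rewrite mulr0 addr0.
have h2 : p = (a, k) by apply: up; split => //=; rewrite -ab subrK.
by move: xk'; rewrite h1 in h2; case: h2 => _ <-; rewrite mulr0 subr0.
Qed.

(** The products of [u] with the trigonometric polynomials [step_poly (W x) n] have integral 0, are
    dominated by |u| and tend almost everywhere to [u] restricted to the arc. *)
Lemma integral_initial_segment : (\int[mu]_(x in `]a%:~R, t[) (u x)%:E = 0)%E.
Proof.
have sub : `]a%:~R, t[ `<=` @Omega R A.
  by move=> x /=; rewrite in_itv /= => ?; exists a => //; move: t_a; lra.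
have -> : (\int[mu]_(x in `]a%:~R, t[) (u x)%:E =
   \int[mu]_(x in @Omega R A) ((EFin \o u) \_ `]a%:~R, t[) x)%E.
  by rewrite -integral_mkcondr; congr integral; rewrite setIidr.
pose f_ n x := (u x * step_poly (W x) n)%:E.
have pmul n : trig_multiplier (@Omega R A) u (2 * pi / N%:R) (fun x => step_poly (W x) n).
  rewrite /step_poly; apply: (trig_multiplierX mO iu).
  rewrite (_ : (fun x => _) = fun x => 1 + (-1) * W x ^+ n); last first.
    by apply/funext => x; rewrite mulN1r.
  apply: M_D; first exact: M_cst.
  by apply: trig_multiplierM; [exact: M_cst|exact: (trig_multiplierX mO iu)].
have f0 n : (\int[mu]_(x in @Omega R A) f_ n x = 0)%E.
  (* Frequency 0 of the annihilation gives the plain integral. *)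
  have [bp Mp] := pmul n; have [_ /(_ 0)[h _]] := Mp _ u_trig.
  have h0 : pairing (@Omega R A) u (fun x => step_poly (W x) n) = 0.
    by rewrite -[RHS]h; congr (pairing _ _ _); apply/funext => x; rewrite !mul0r cos0 mulr1 mul1r.
  have fin : (\int[mu]_(x in @Omega R A) f_ n x)%E \is a fin_num.
    apply: integrable_fin_num; first exact: mO.
    exact: (integrable_bounded_measurable mO iu bp).
  by rewrite -(fineK fin); congr EFin; exact: h0.
have mI : measurable (`]a%:~R, t[ : set R) by exact: measurable_itv.
have [|||||_ _] := @dominated_convergence _ _ _ mu (@Omega R A) mO f_
  ((EFin \o u) \_ `]a%:~R, t[) (fun x => `|u x|%:E).
- move=> n; have [bp _] := pmul n.
  exact: measurable_int (integrable_bounded_measurable mO iu bp).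
- apply: (measurable_restrict (EFin \o u) mI mO).1.
  apply: (@measurable_funS _ _ _ _ (@Omega R A)) (measurable_int mu iu); first exact: mO.
  exact: subIsetl.
(* At the two ends W = 1/2, where neither limit of [step_poly] applies. *)
- have null_ends : mu.-negligible [set a%:~R; t].
    apply/negligibleP; first by apply: measurableU; exact: measurable_set1.
    by apply: countable_lebesgue_measure0; apply: finite_set_countable; exact: finite_set2.
  apply: negligibleS null_ends.
  + move=> x /= nx; apply: contrapT => xat; apply: nx => Ox.
    have lim_u l : step_poly (W x) @ \oo --> (l : R) -> f_ ^~ x @ \oo --> (u x * l)%:E.
      move=> pl; apply: cvg_EFin; first by near=> n.
      by apply: cvgMr pl.
    rewrite patchE; case: ifPn; rewrite ?inE ?notin_setE /= in_itv /= => xI.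
      rewrite -[u x]mulr1; apply/lim_u/step_poly_cvg1.
      by rewrite W_lt // andbT; case/andP: (W_bounds x).
    rewrite [X in _ --> X](_ : _ = (u x * 0)%:E); last by rewrite mulr0.
    apply/lim_u/step_poly_cvg0.
    rewrite W_gt //=; first by case/andP: (W_bounds x).
    apply/negP => /andP[]; rewrite !le_eqVlt => /orP[/eqP ax|ax] /orP[/eqP xt|xt].
    - by apply: xat; left.
    - by apply: xat; left.
    - by apply: xat; right.
    - by apply: xI; rewrite ax xt.
- by move/(integrable_abse): iu.
- apply: aeW => x n _; rewrite /f_ abse_EFin lee_fin normrM ler_piMr //.
  by have /andP[? ?] := step_poly_bounds n (W_bounds x); rewrite ger0_norm.
under eq_fun do rewrite f0.
by move/(cvg_unique _ (@cvg_cst _ _ _ _ _)) => <-.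
Unshelve. all: by end_near. Qed.

End Arc.
(** The indefinite integral of [u] from [a] vanishes on the unit interval, and its derivative is [u]
    almost everywhere. *)
Lemma negligible_unit_itv (a : int) : a \in A ->
  mu.-negligible (unit_itv a `&` [set x | u x != 0]).
Proof.
move=> aA.
have mI : measurable (@unit_itv R a) by exact: measurable_itv.
have sub : @unit_itv R a `<=` @Omega R A.
  by move=> x; rewrite /unit_itv /= in_itv /= => ?; exists a.
have iua : mu.-integrable (unit_itv a) (EFin \o u) by apply: integrableS iu.
pose f : R -> R := u \_ (unit_itv a).
have fE : (EFin \o f) = (EFin \o u) \_ (unit_itv a).
  by apply/funext => x; rewrite /f /= !patchE; case: ifP.
have iT : mu.-integrable setT (EFin \o f).
  by rewrite fE; apply: (integrable_mkcond _ _).1; [exact: mI|exact: iua].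
have if_ y : mu.-integrable [set` Interval (BLeft a%:~R) (BRight y)] (EFin \o f).
  by apply: integrableS iT => //; exact: measurable_itv.
have lf : locally_integrable setT f by exact: integrable_locally_restrict.
have := FTC1 if_ lf; set F := fun x => _ => ftc.
have F0 x : a%:~R < x < a%:~R + 1 -> F x = 0.
  move=> /andP[ax xa]; rewrite /F /Rintegral integral_itv_bndoo; last first.
    by apply: measurable_funS (measurable_int _ iT).
  rewrite -[RHS](congr1 fine (integral_initial_segment aA ax xa)); congr fine.
  apply: eq_integral => z; rewrite inE /= in_itv /= => /andP[az zx].
  by rewrite /f patchE mem_set // /unit_itv /= in_itv /= (ltW az) (lt_trans zx xa).
have n_a : mu.-negligible [set (a%:~R : R)].
  by apply/negligibleP; [exact: measurable_set1|exact: lebesgue_measure_set1].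
apply: negligibleS (negligibleU ftc n_a) => x [].
rewrite /unit_itv /= in_itv /= => /andP[]; rewrite le_eqVlt => /orP[/eqP ->|ax] xa ux0; first by right.
left => /(_ ax)[_ dF]; move: ux0; suff -> : u x = 0 by rewrite eqxx.
have -> : u x = f x by rewrite /f patchE mem_set // /unit_itv /= in_itv /= (ltW ax).
rewrite -dF derive1E (@near_eq_derive _ _ _ _ (cst 0)) ?derive_cst //.
near=> z; apply: F0; apply/andP; split; near: z.
  exact: lt_nbhsr.
exact: lt_nbhsl.
Unshelve. all: by end_near. Qed.

Lemma negligible_Omega : mu.-negligible (@Omega R A `&` [set x | u x != 0]).
Proof.
suff main (s : seq int) : {subset s <= A} ->
    mu.-negligible (\big[setU/set0]_(a <- s) unit_itv a `&` [set x | u x != 0]).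
  by rewrite Omega_bigsetU; apply: main.
elim: s => [|a s IH] sA; first by rewrite big_nil set0I; exact: negligible_set0.
rewrite big_cons setIUl; apply: negligibleU.
  by apply: negligible_unit_itv; apply: sA; rewrite inE eqxx.
by apply: IH => b bs; apply: sA; rewrite inE bs orbT.
Qed.

End Completeness.

(** * Completeness for complex functions *)

Lemma integrable_of_square (R : realType) (D : set R) (u v : R -> R) :
  measurable D -> (@lebesgue_measure R D < +oo)%E ->
  measurable_fun D u -> measurable_fun D v ->
  (\int[@lebesgue_measure R]_(x in D) (u x ^+ 2 + v x ^+ 2)%:E < +oo)%E ->
  (@lebesgue_measure R).-integrable D (EFin \o u).
Proof.
move=> mD finD mu_ mv fin.
have m2 : measurable_fun D (fun x => u x ^+ 2 + v x ^+ 2).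
  by apply: measurable_funD; exact: measurable_funX.
(* On a set of finite measure, 1 + u^2 + v^2 is an integrable majorant of |u|. *)
apply: (@le_integrable _ _ R (@lebesgue_measure R) D mD (EFin \o u) (fun x => (1 + (u x ^+ 2 + v x ^+ 2))%:E)).
- exact/measurable_EFinP.
- move=> x _ /=; rewrite lee_fin [leRHS]ger0_norm; last first.
    by rewrite !addr_ge0 ?sqr_ge0.
  have := sqr_ge0 (u x - 1); have := sqr_ge0 (u x + 1); have := sqr_ge0 (v x).
  by have := sqr_ge0 (u x); case: (ger0P (u x)) => _; nra.
- rewrite (_ : (fun x => _) = ((EFin \o cst (1%R : R)) \+ (fun x => (u x ^+ 2 + v x ^+ 2)%R%:E))%E) //.
  apply: integrableD => //.
    apply/integrableP; split; first exact/measurable_EFinP.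
    rewrite (eq_integral (cst 1%E)) => [|x _]; last by rewrite /= normr1.
    by rewrite integral_cst // mul1e.
  apply/integrableP; split; first exact/measurable_EFinP.
  move: fin; congr (_ < _)%E; apply: eq_integral => x _ /=.
  by rewrite ger0_norm // addr_ge0 ?sqr_ge0.
Qed.

Section Separation.
Variables (R : realType) (D : set R) (u v : R -> R).
Notation mu := (@lebesgue_measure R).
Hypothesis mD : measurable D.
Hypotheses (iu : mu.-integrable D (EFin \o u)) (iv : mu.-integrable D (EFin \o v)).

(** The cosine is even and the sine odd, so the relations at w and -w separate. Thus u + i v is
    reduced to two real functions. *)
Lemma pairing_separation (w : R) :
  (forall s : R, s \in [:: w; - w] ->
    (\int[mu]_(x in D) (u x * cos (s * x) + v x * sin (s * x))%:E = 0)%E) ->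
  pairing D u (fun x => cos (w * x)) = 0 /\ pairing D v (fun x => sin (w * x)) = 0.
Proof.
move=> h.
have bc s := bounded_measurable_cosM D s; have bs s := bounded_measurable_sinM D s.
have E s : s \in [:: w; - w] -> pairing D u (fun x => cos (s * x)) + pairing D v (fun x => sin (s * x)) = 0.
  move=> /h hs; rewrite /pairing -RintegralD //; last first.
  - exact: (integrable_bounded_measurable mD iv (bs s)).
  - exact: (integrable_bounded_measurable mD iu (bc s)).
  by rewrite /Rintegral hs.
have e1 := E w (mem_head _ _); have := E (- w); rewrite !inE eqxx orbT => /(_ isT).
have -> : pairing D u (fun x => cos (- w * x)) = pairing D u (fun x => cos (w * x)).
  by congr (pairing _ _ _); apply/funext => x; rewrite mulNr cosN.
have -> : pairing D v (fun x => sin (- w * x)) = - pairing D v (fun x => sin (w * x)).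
  rewrite -[RHS]mulN1r -(pairingZ mD iv) //; congr (pairing _ _ _); apply/funext => x.
  by rewrite mulNr sinN mulN1r.
by move: e1; lra.
Qed.

End Separation.

Lemma direct_sum_spectrum (R : realType) (A : {fset int}) :
  (1 < #|` A|%fset)%N -> direct_sum_NZ A #|` A|%fset ->
  spectrum (@Omega R A) [set x : R | exists k : int, x = k%:~R / (#|` A|%fset)%:R].
Proof.
move=> N1 ds; set N := #|` A|%fset in N1 ds *.
have mO := @measurable_Omega R A; have fO := @measure_Omega_lty R A.
have NR : N%:R != 0 :> R by rewrite pnatr_eq0; lia.
split => //.
  move=> _ _ [k ->] [k' ->] kk'; rewrite -mulrBl -intrB.
  apply: direct_sum_orthogonal => //; first lia.
  by apply: contraNneq kk' => /eqP; rewrite subr_eq0 => /eqP ->.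
move=> u v mu_ mv fin h.
have iu := integrable_of_square mO fO mu_ mv fin.
have iv : (@lebesgue_measure R).-integrable (@Omega R A) (EFin \o v).
  apply: (integrable_of_square mO fO mv mu_).
  by under eq_integral do rewrite addrC.
have iNu : (@lebesgue_measure R).-integrable (@Omega R A) (EFin \o (fun x => - u x)).
  rewrite (_ : _ \o _ = (\- (EFin \o u))%E) //; exact: integrableN.
pose fr (k : int) : R := k%:~R * (2 * pi / N%:R).
have frE k : fr k = 2 * pi * (k%:~R / N%:R) by rewrite /fr; field.
have hk k s : s \in [:: fr k; - fr k] ->
    (\int[@lebesgue_measure R]_(x in @Omega R A) (u x * cos (s * x) + v x * sin (s * x))%:E = 0)%E
    /\ (\int[@lebesgue_measure R]_(x in @Omega R A) (v x * cos (s * x) + - u x * sin (s * x))%:E = 0)%E.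
  move=> sk; have [k' ->] : exists k' : int, s = fr k'.
    move: sk; rewrite !inE => /orP[/eqP ->|/eqP ->]; first by exists k.
    by exists (- k); rewrite /fr intrN mulNr.
  rewrite frE; have [|h1 h2] := h (k'%:~R / N%:R); first by exists k'.
  by split=> //; rewrite -[RHS]h2; apply: eq_integral => x _; rewrite mulNr.
have sep1 k := pairing_separation mO iu iv (fun s sk => (hk k s sk).1).
(* The pair (v, -u) represents -i (u + i v); it yields [v] against cosines and [u] against sines. *)
have sep2 k := pairing_separation mO iv iNu (fun s sk => (hk k s sk).2).
have b1 := bounded_measurable_cst (@Omega R A) 1.
have u_trig : trig_annihilated (@Omega R A) u (2 * pi / N%:R) (fun=> 1).
  split=> // k; have [uc _] := sep1 k; have [_ us] := sep2 k; split.
    by rewrite -[RHS]uc; congr (pairing _ _ _); apply/funext => x; rewrite mul1r.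
  rewrite -[RHS]oppr0 -[X in _ = - X]us -mulN1r.
  rewrite -(pairingZ mO iNu); last exact: bounded_measurable_sinM.
  by apply: eq_Rintegral => x _; rewrite mul1r mulN1r mulrNN.
have v_trig : trig_annihilated (@Omega R A) v (2 * pi / N%:R) (fun=> 1).
  split=> // k; have [_ vs] := sep1 k; have [vc _] := sep2 k; split.
    by rewrite -[RHS]vc; congr (pairing _ _ _); apply/funext => x; rewrite mul1r.
  by rewrite -[RHS]vs; congr (pairing _ _ _); apply/funext => x; rewrite mul1r.
have nu := negligible_Omega N1 ds iu u_trig.
have nv := negligible_Omega N1 ds iv v_trig.
apply: negligibleS (negligibleU nu nv) => x [Ox /= [ux|vx]]; [by left|by right].
Qed.

(** * From a spectrum to a complete residue system *)

(** The matrix of the [f a z] has more rows than columns, hence a nonzero left kernel. *)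
Lemma exists_nontrivial_relation (F : fieldType) (T : eqType) (s : seq F)
    (A : seq T) (f : T -> F -> F) : uniq A -> (size s < size A)%N ->
  exists g : T -> F, (exists2 a, a \in A & g a != 0) /\
    forall z, z \in s -> \sum_(a <- A) g a * f a z = 0.
Proof.
move=> uA sA.
have [a0 _] : exists a0, a0 \in A by case: (A) sA => // a l _; exists a; rewrite inE eqxx.
pose X : 'M[F]_(size A, size s) := \matrix_(i, j) f (nth a0 A i) (nth 0 s j).
have : kermx X != 0.
  by rewrite kermx_eq0 /row_free neq_ltn (leq_ltn_trans (rank_leq_col X)).
case/rowV0Pn => v /sub_kermxP vX vn0.
(* Outside [A] the index is out of range and [g] takes the default value 0. *)
pose g a := oapp (fun i : 'I_(size A) => v 0 i) 0 (insub (index a A)).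
have gE (i : 'I_(size A)) : g (nth a0 A i) = v 0 i by rewrite /g index_uniq // valK.
exists g; split.
  have [i vi] : exists i, v 0 i != 0.
    apply/existsP; apply: contraNT vn0; rewrite negb_exists => /forallP v0.
    by apply/eqP/rowP => i; rewrite mxE; apply/eqP; have := v0 i; rewrite negbK.
  by exists (nth a0 A i); rewrite ?mem_nth ?gE.
move=> z zs; rewrite (big_nth a0) big_mkord.
have zi : (index z s < size s)%N by rewrite index_mem.
have := congr1 (fun m : 'M[F]_(1, size s) => m 0 (Ordinal zi)) vX; rewrite !mxE => vX0.
rewrite -[RHS]vX0; apply: eq_bigr => i _.
by rewrite gE !mxE /= nth_index.
Qed.

(** * Exponential sums and step functions on Omega *)

Section Spectral.
Variable R : realType.
Notation mu := (@lebesgue_measure R).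

Definition cis (t : R) : R[i] := (cos t +i* sin t)%C.

Lemma cisD s t : cis (s + t) = cis s * cis t.
Proof. by rewrite /cis cosD sinD; congr (_ +i* _)%C; rewrite addrC [X in X + _]mulrC. Qed.

Lemma cis_neq0 t : cis t != 0.
Proof.
apply/negP => /eqP [c0 s0]; have := cos2Dsin2 t.
by rewrite c0 s0 expr0n addr0 => /esym/eqP; rewrite oner_eq0.
Qed.

Lemma cisX t n : cis t ^+ n = cis (t * n%:R).
Proof.
elim: n => [|n IH]; first by rewrite mulr0 /cis cos0 sin0.
by rewrite exprS IH -cisD -natr1 mulrDr mulr1 addrC.
Qed.

Lemma cisB s t : cis (s - t) = cis s / cis t.
Proof. by apply: (mulIf (cis_neq0 t)); rewrite divfK ?cis_neq0 // -cisD subrK. Qed.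

Lemma sum_complex (I : Type) (r : seq I) (x y : I -> R) :
  \sum_(i <- r) (x i +i* y i)%C = ((\sum_(i <- r) x i) +i* (\sum_(i <- r) y i))%C.
Proof.
elim: r => [|i r IH]; first by rewrite !big_nil.
by rewrite !big_cons IH.
Qed.

Variable A : {fset int}.
Let mO : measurable (@Omega R A). Proof. exact: measurable_Omega. Qed.

(** The integral of exp(i w x) over Omega is this sum times (cis w - 1) / (i w), a nonzero
    factor. *)
Lemma orthogonal_cis_root (w : R) : w != 0 -> cis w != 1 ->
  (\int[mu]_(x in @Omega R A) (cos (w * x))%:E = 0)%E ->
  (\int[mu]_(x in @Omega R A) (sin (w * x))%:E = 0)%E ->
  \sum_(a <- A) cis (w * a%:~R) = 0.
Proof.
move=> w0 cw1 hc hs.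
apply: (mulfI (_ : cis w - 1 != 0)); first by rewrite subr_eq0.
rewrite mulr0 mulrBl mul1r mulr_sumr -sumrB.
move: hc hs; rewrite !integral_Omega; try by [exact: measurable_cosM|exact: measurable_sinM].
rewrite (eq_bigr (fun a : int => ((sin (w * (a%:~R + 1)) - sin (w * a%:~R)) / w)%:E)); last first.
  by move=> a _; rewrite /unit_itv integral_cosM ?ltrDl.
rewrite sumEFin => -[] /eqP; rewrite -mulr_suml mulf_eq0 invr_eq0 (negPf w0) orbF => /eqP hs.
rewrite (eq_bigr (fun a : int => ((cos (w * a%:~R) - cos (w * (a%:~R + 1))) / w)%:E)); last first.
  by move=> a _; rewrite /unit_itv integral_sinM ?ltrDl.
rewrite sumEFin => -[] /eqP; rewrite -mulr_suml mulf_eq0 invr_eq0 (negPf w0) orbF => /eqP hc.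
rewrite (eq_bigr (fun a : int => ((cos (w * (a%:~R + 1)) - cos (w * a%:~R)) +i*
   (sin (w * (a%:~R + 1)) - sin (w * a%:~R)))%C)); last first.
  by move=> a _; rewrite -cisD (_ : w + w * a%:~R = w * (a%:~R + 1)) // mulrDr mulr1 addrC.
rewrite sum_complex hs; congr (_ +i* _)%C.
rewrite -[RHS]oppr0 -[X in _ = - X]hc -sumrN; apply: eq_bigr => a _; by rewrite opprB.
Qed.

Variable c : int -> R.
Definition step_fun (x : R) := \sum_(a <- A) c a * \1_(@unit_itv R a) x.

Lemma measurable_step_fun (D : set R) : measurable_fun D step_fun.
Proof.
apply: measurable_sum => a; apply: measurable_funM => //.
by apply: measurable_indic; exact: measurable_itv.
Qed.

Lemma step_funE (a : int) (x : R) : a \in A -> unit_itv a x -> step_fun x = c a.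
Proof.
move=> aA ax; rewrite /step_fun (bigD1_seq a) ?fset_uniq //=.
rewrite indicE mem_set // mulr1 big1 ?addr0 // => b ba.
rewrite indicE memNset ?mulr0 // => bx; case/eqP: ba; exact: unit_itv_inj bx ax.
Qed.
End Spectral.

(** If all exp(2 pi i l) were in [s], a relation [g] would give a step function orthogonal to every
    exponential, yet equal to a nonzero constant on a unit interval, against completeness. *)
Lemma spectrum_escapes_finite (R : realType) (A : {fset int}) (Lam : set R) (s : seq R[i]) :
  (forall a, a \in A -> 0 <= a) -> spectrum (@Omega R A) Lam ->
  (size s < #|` A|%fset)%N ->
  exists l, Lam l /\ cis (2 * pi * l) \notin s.
Proof.
move=> A0 [mO _ _ complete] lt_s; apply: contrapT => noesc.
have esc l : Lam l -> cis (2 * pi * l) \in s.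
  by move=> Ll; apply: contrapT => /negP ns; apply: noesc; exists l.
(* The conjugate is that of the scalar product of L^2; by [A0] the exponent |a| is [a] itself. *)
have [g [[a0 a0A ga0] rel]] := exists_nontrivial_relation
  (fun (a : int) (z : R[i]) => (z ^+ `|a|%N)^*%C) (fset_uniq A) lt_s.
pose p a := complex.Re (g a); pose q a := complex.Im (g a).
pose u := step_fun A p; pose v := step_fun A q.
have mu_ D : measurable_fun D u by exact: measurable_step_fun.
have mv D : measurable_fun D v by exact: measurable_step_fun.
have orth (l : R) : Lam l -> let w := 2 * pi * l in
    \sum_(a <- A) (p a * cos (w * a%:~R) + q a * sin (w * a%:~R)) = 0 /\
    \sum_(a <- A) (q a * cos (w * a%:~R) - p a * sin (w * a%:~R)) = 0.
  move=> /esc/rel + w; rewrite -/w.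
  rewrite (eq_big_seq (fun a : int => ((p a * cos (w * a%:~R) + q a * sin (w * a%:~R)) +i*
     (q a * cos (w * a%:~R) - p a * sin (w * a%:~R)))%C)); last first.
    move=> a aA; rewrite cisX.
    have -> : (absz a)%:R = a%:~R :> R by rewrite -[in RHS](gez0_abs (A0 _ aA)).
    rewrite /p /q; case: (g a) => x y /=; congr (_ +i* _)%C; ring.
  by rewrite sum_complex => -[-> ->].
have unitE (h : R -> R -> R -> R) : measurable_fun (@Omega R A) (fun x => h (u x) (v x) x) ->
    (\int[@lebesgue_measure R]_(x in @Omega R A) (h (u x) (v x) x)%:E =
     \sum_(a <- A) \int[@lebesgue_measure R]_(x in unit_itv a) (h (p a) (q a) x)%:E)%E.
  move=> mh; rewrite integral_Omega //; apply: eq_big_seq => a aA.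
  by apply: eq_integral => x; rewrite inE => ax; rewrite /u /v !(step_funE _ aA ax).
have := complete u v (mu_ _) (mv _).
case.
- rewrite (unitE (fun x y _ => x ^+ 2 + y ^+ 2)); last first.
    by apply: measurable_funD; exact: measurable_funX.
  rewrite (eq_bigr (fun a => (p a ^+ 2 + q a ^+ 2)%:E)) ?sumEFin ?ltry // => a _.
  rewrite integral_cst; last exact: measurable_itv.
  by rewrite [X in (_ * X)%E]measure_unit_itv mule1.
- move=> l Ll; have [r1 r2] := orth l Ll; set w := 2 * pi * l in r1 r2 *.
  split.
    rewrite (unitE (fun x y z => x * cos (w * z) + y * sin (w * z))); last first.
      by apply: measurable_funD; apply: measurable_funM => //; [exact: measurable_cosM|exact: measurable_sinM].
    under eq_bigr do rewrite integral_trig_unit.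
    by rewrite sumEFin big_split /= -!mulr_sumr r1 r2 !mulr0 addr0.
  rewrite (unitE (fun x y z => y * cos (w * z) - x * sin (w * z))); last first.
    by apply: measurable_funB; apply: measurable_funM => //; [exact: measurable_cosM|exact: measurable_sinM].
  (* This is the previous integrand with (q, -p) in place of (p, q). *)
  under eq_bigr => a _ do under eq_integral => x _ do rewrite -mulNr.
  under eq_bigr do rewrite integral_trig_unit.
  rewrite sumEFin big_split /= -!mulr_sumr.
  under eq_bigr do rewrite mulNr.
  rewrite r2 mulr0 add0r.
  rewrite (_ : \sum_(a <- A) _ = - \sum_(a <- A) (p a * cos (w * a%:~R) + q a * sin (w * a%:~R))).
    by rewrite r1 oppr0 mulr0.
  by rewrite -sumrN; apply: eq_bigr => a _; rewrite mulNr opprD.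
move=> N [mN N0 subN].
have : (@lebesgue_measure R (unit_itv a0) <= @lebesgue_measure R N)%E.
  apply: le_measure; rewrite ?inE //; first exact: measurable_itv.
  move=> x ax; apply: subN; split => /=.
    by exists a0 => //; move: ax; rewrite /unit_itv /= in_itv.
  rewrite /u /v !(step_funE _ a0A ax) /p /q.
  move: ga0; rewrite eq_complex negb_and /= => /orP[]; by [left|right].
by rewrite N0 measure_unit_itv lee_fin ler10.
Qed.

(** Values are added one at a time: fewer than |A| of them never exhaust the spectrum. *)
Lemma spectrum_classes (R : realType) (A : {fset int}) (Lam : set R) (k : nat) :
  (forall a, a \in A -> 0 <= a) -> spectrum (@Omega R A) Lam ->
  (k <= #|` A|%fset)%N ->
  exists s : seq R[i], [/\ uniq s, size s = k &
    forall z, z \in s -> exists2 l, Lam l & z = cis (2 * pi * l)].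
Proof.
move=> A0 sp; elim: k => [|k IH] kA; first by exists [::].
have [s [us ss sl]] := IH (ltnW kA).
have [|l [Ll ls]] := spectrum_escapes_finite A0 sp (s := s); first by rewrite ss.
exists (cis (2 * pi * l) :: s); split; rewrite /= ?ls ?ss //.
by move=> z; rewrite inE => /orP[/eqP ->|/sl //]; exists l.
Qed.

(** Orthogonality makes quotients of distinct values exp(2 pi i l) roots of the exponential sum over
    [A], so [spectral_residues] counts one element of [A] per residue. *)
Lemma spectral_complete_residue_system (R : realType) (M : nat) (A : {fset int}) :
  (forall a, a \in A -> 0 <= a <= M%:Z - 1) -> (0 < #|` A|%fset)%N ->
  (2 * M < 3 * #|` A|%fset)%N -> spectral_set (@Omega R A) ->
  complete_residue_system A #|` A|%fset.
Proof.
move=> AM N0 lt_M [Lam sp].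
have A0 a : a \in A -> 0 <= a by move=> /AM/andP[].
have [s [us ss sl]] := spectrum_classes A0 sp (leqnn _).
pose An := [seq absz a | a <- A].
have sAn : size An = #|` A|%fset by rewrite size_map.
have [_ _ orth _] := sp.
have cnt r : (r < #|` A|%fset)%N -> count (fun a => a %% #|` A|%fset == r)%N An = 1%N.
  rewrite -sAn; apply: (spectral_residues (M := M) (s := s)); rewrite ?sAn //.
  - by apply/allP => _ /mapP[a aA ->]; have := AM _ aA; lia.
  - by apply/negP => /sl[l _ /esym/eqP]; rewrite (negPf (cis_neq0 _)).
  - move=> x y /sl[l Ll ->] /sl[l' Ll' ->] ll'.
    have lne : l != l' by apply: contraNneq ll' => ->.
    rewrite -cisB -mulrBr.
    rewrite big_map; have [h1 h2] := orth l l' Ll Ll' lne.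
    rewrite -[RHS](orthogonal_cis_root _ _ h1 h2).
    + by apply: eq_big_seq => a aA; rewrite cisX -[in RHS](gez0_abs (A0 _ aA)).
    + by rewrite !mulf_neq0 ?subr_eq0 // gt_eqF // pi_gt0.
    + rewrite mulrBr cisB; apply: contraNneq ll' => /(congr1 ( *%R^~ (cis (2 * pi * l')))).
      by rewrite divfK ?cis_neq0 // mul1r => ->.
move=> r r0.
have rN : (absz r < #|` A|%fset)%N by lia.
have := cnt _ rN; rewrite count_map -size_filter.
set fl := seq.filter _ _ => sfl.
have flE a : a \in A -> (a \in fl) = ((a %% (#|` A|%fset)%:Z)%Z == (r %% (#|` A|%fset)%:Z)%Z).
  move=> aA; rewrite mem_filter aA andbT /=.
  have a0 := A0 _ aA.
  rewrite -[in RHS](gez0_abs a0) -[in RHS](@gez0_abs r); last lia.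
  by rewrite !modz_nat eqz_nat (modn_small rN).
have [a0 fla] : exists a0, fl = [:: a0].
  by move: sfl; case: (fl) => [|a [|]] // _; exists a.
have a0A : a0 \in A.
  have : a0 \in fl by rewrite fla inE.
  by rewrite mem_filter => /andP[].
exists a0; split.
  by split=> //; apply/eqP; rewrite -flE // fla inE.
by move=> b [bA /eqP]; rewrite -flE // fla inE => /eqP.
Qed.

Theorem mainTheorem7 (R : realType) (M : nat) (A : {fset int}) :
  (forall a, a \in A -> 0 <= a <= M%:Z - 1) ->
  0 \in A ->
  (2 <= #|` A|%fset)%N ->
  (2 * M < 3 * #|` A|%fset)%N ->
  [<-> tiles_Z A;
       spectral_set (@Omega R A);
       complete_residue_system A #|` A|%fset;
       direct_sum_NZ A #|` A|%fset;
       spectrum (@Omega R A) [set x : R | exists k : int, x = k%:~R / (#|` A|%fset)%:R]].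
Proof.
move=> AM A0 N2 lt_M.
have N0 : (0 < #|` A|%fset)%N by apply: ltnW.
have crs_ds := complete_residue_system_direct_sum N0.
have ds_sp := @direct_sum_spectrum R A N2.
have spectral_crs := spectral_complete_residue_system (R := R) AM N0 lt_M.
(* The cycle is closed in the order of the list: tilings reach spectral sets through the last three
   conditions, and the spectrum of the last one returns to tilings through residues and the direct
   sum. *)
tfae.
- move=> /(tiles_Z_complete_residue_system AM A0 lt_M)/crs_ds/ds_sp sp.
  by exists [set x : R | exists k : int, x = k%:~R / (#|` A|%fset)%:R].
- exact: spectral_crs.
- exact: crs_ds.
- exact: ds_sp.
- move=> sp; apply: direct_sum_tiles_Z; apply: crs_ds; apply: spectral_crs.
  by exists [set x : R | exists k : int, x = k%:~R / (#|` A|%fset)%:R].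
Qed.
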